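(* For any layer $\ell$, the direction loss $\mathcal{L}_{\mathrm{dir}}(\ell)$ and the geometry loss $\mathcal{L}_{\mathrm{geo}}(\ell)$ (defined in the context) are unchanged by: 1. adding any position-independent offset to either trajectory, $h^S_{\ell,t}\mapsto h^S_{\ell,t}+c^S_\ell$ and $h^T_{\ell,t}\mapsto h^T_{\ell,t}+c^T_\ell$; 2. multiplying any transition by a positive scalar before normalization, $\Delta h^{S/T}_{\ell,i}\mapsto s^{S/T}_{\ell,i}\,\Delta h^{S/T}_{\ell,i}$ (with $s^{S/T}_{\ell,i}>0$; the superscript $S/T$ means that this applies to the student and to the teacher, each with its own scalars), up to the numerical $\epsilon$ in the denominator of the normalized directions. In addition, for any orthogonal maps $R_S,R_T$, the geometry loss $\mathcal{L}_{\mathrm{geo}}(\ell)$ is unchanged under $d^S_{\ell,i}\mapsto R_S d^S_{\ell,i}$ and $d^T_{\ell,i}\mapsto R_T d^T_{\ell,i}$; the direction loss $\mathcal{L}_{\mathrm{dir}}(\ell)$ has the same orthogonal invariance when $R_S=R_T$. In contrast, the pointwise state loss $\|h^S_{\ell,t}-h^T_{\ell,t}\|_2^2$ generally changes under these transformations.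
   Context: Fix a layer $\ell$ of a transformer. For each position $t$ of a generated token sequence, $h^S_{\ell,t}$ and $h^T_{\ell,t}$ are real vectors of the same dimension $n$, namely the hidden states at layer $\ell$ of a student model ($S$) and of a teacher model ($T$); the families $(h^S_{\ell,t})_t$ and $(h^T_{\ell,t})_t$ are called the student and teacher trajectories. Let $w_1<\cdots<w_m$ be the selected positions. For $X\in\{S,T\}$ and $i=1,\dots,m-1$, the transitions are $$\Delta h^X_{\ell,i}=h^X_{\ell,w_{i+1}}-h^X_{\ell,w_i},$$ and the normalized transition directions are $$d^X_{\ell,i}=\frac{\Delta h^X_{\ell,i}}{\|\Delta h^X_{\ell,i}\|_2+\epsilon},$$ where $\epsilon$ is a numerical constant in the denominator. The direction loss is $$\mathcal{L}_{\mathrm{dir}}(\ell)=\frac{1}{m-1}\sum_{i=1}^{m-1}\bigl(1-\langle d^S_{\ell,i},d^T_{\ell,i}\rangle\bigr),$$ with $\langle\cdot,\cdot\rangle$ the Euclidean inner product. Let $D^X_\ell$ be the matrix whose rows are $d^X_{\ell,i}$, $i=1,\dots,m-1$, and let $G^X_\ell=D^X_\ell(D^X_\ell)^\top$ be the corresponding Gram matrix. The geometry loss is $$\mathcal{L}_{\mathrm{geo}}(\ell)=\frac{1}{(m-1)^2}\bigl\|G^S_\ell-G^T_\ell\bigr\|_F^2,$$ where $\|\cdot\|_F$ is the Frobenius norm. *)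

(* Defs.v *)
From HB Require Import structures.
From mathcomp Require Import all_boot all_order all_algebra.
From mathcomp Require Import all_classical all_reals all_analysis.
From mathcomp Require Import ring.
Set Implicit Arguments.
Unset Strict Implicit.
Unset Printing Implicit Defensive.
Import Order.TTheory GRing.Theory Num.Theory.
Import numFieldNormedType.Exports.
Local Open Scope classical_set_scope.
Local Open Scope ring_scope.

(* A trajectory of N hidden states of dimension n (at a fixed layer) is a matrix
   h : 'M[R]_(N, n) whose row t is the state at position t.  The m = k + 1
   selected positions are w : 'I_k.+1 -> 'I_N, counted from 0, so that there are
   m - 1 = k transitions, the i-th one (i : 'I_k) going from [w (from_pos i)] to
   [w (to_pos i)]. *)

Definition from_pos {k : nat} (i : 'I_k) : 'I_k.+1 := widen_ord (leqnSn k) i.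
Definition to_pos {k : nat} (i : 'I_k) : 'I_k.+1 := lift ord0 i.

Section Losses.
Context {R : realType}.

(* The library norm on matrices is the sup norm, hence these definitions. *)
Definition inner {n} (u v : 'rV[R]_n) : R := \sum_j u 0 j * v 0 j.
Definition norm2 {n} (u : 'rV[R]_n) : R := Num.sqrt (inner u u).
Definition normF {p q} (A : 'M[R]_(p, q)) : R :=
  Num.sqrt (\sum_i \sum_j A i j ^+ 2).

Definition transitions {N n k} (w : 'I_k.+1 -> 'I_N) (h : 'M[R]_(N, n)) :
    'M[R]_(k, n) :=
  \matrix_(i < k) (row (w (to_pos i)) h - row (w (from_pos i)) h).

(* With eps = 0 a null row is sent to 0, since 0^-1 = 0. *)
Definition directions {n k} (eps : R) (D : 'M[R]_(k, n)) : 'M[R]_(k, n) :=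
  \matrix_(i < k) ((norm2 (row i D) + eps)^-1 *: row i D).

Definition gram {n k} (d : 'M[R]_(k, n)) : 'M[R]_k := d *m d^T.

(* Both losses as functions of the matrices of directions. *)
Definition dir_loss {n k} (dS dT : 'M[R]_(k, n)) : R :=
  k%:R^-1 * \sum_(i < k) (1 - inner (row i dS) (row i dT)).
Definition geo_loss {n k} (dS dT : 'M[R]_(k, n)) : R :=
  (k%:R ^+ 2)^-1 * normF (gram dS - gram dT) ^+ 2.

Definition state_loss {N n} (hS hT : 'M[R]_(N, n)) (t : 'I_N) : R :=
  norm2 (row t hS - row t hT) ^+ 2.

Definition add_offset {N n} (c : 'rV[R]_n) (h : 'M[R]_(N, n)) : 'M[R]_(N, n) :=
  \matrix_(t < N) (row t h + c).

Definition scale_rows {n k} (s : 'I_k -> R) (D : 'M[R]_(k, n)) : 'M[R]_(k, n) :=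
  \matrix_(i < k) (s i *: row i D).

Definition orthogonal_map {n} (Q : 'M[R]_n) : Prop := Q^T *m Q = 1%:M.

(* Vectors are rows: [apply_rows Q v] has rows (Q v_i^T)^T. *)
Definition apply_rows {p n} (Q : 'M[R]_n) (v : 'M[R]_(p, n)) : 'M[R]_(p, n) :=
  v *m Q^T.

(* The trajectory whose transitions are D and which keeps the initial state of h:
   every state at or after the end of transition i is shifted by the change made
   to transition i.  See [transitions_set_transitions]. *)
Definition set_transitions {N n k} (w : 'I_k.+1 -> 'I_N) (h : 'M[R]_(N, n))
    (D : 'M[R]_(k, n)) : 'M[R]_(N, n) :=
  \matrix_(t < N) (row t h +
    \sum_(i < k | (w (to_pos i) <= t)%N) (row i D - row i (transitions w h))).

(* Topological genericity, for pairs of a student and a teacher trajectory. *)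
Definition generic {N n} (A : set ('M[R]_(N, n) * 'M[R]_(N, n))) : Prop :=
  open A /\ dense A.

Lemma transitions_set_transitions {N n k} (w : 'I_k.+1 -> 'I_N)
    (h : 'M[R]_(N, n)) (D : 'M[R]_(k, n)) :
  (forall i j : 'I_k.+1, (i < j)%N -> (w i < w j)%N) ->
  transitions w (set_transitions w h D) = D.
Proof.
move=> hw; apply/row_matrixP => i.
have wle (a b : 'I_k.+1) : (w a <= w b)%N = (a <= b)%N.
  case: (ltnP b a) => [/hw|]; first by rewrite ltnNge => /negbTE.
  by rewrite leq_eqVlt => /orP[/eqP/val_inj ->|/hw /ltnW ->]; rewrite ?leqnn.
rewrite rowK !rowK (bigD1 i) //=.
rewrite [X in _ + (_ + X) - _](eq_bigl
    (fun j => (w (to_pos j) <= w (from_pos i))%N)); last first.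
  move=> j; rewrite !wle /= /bump !leq0n /= !add1n ltnS.
  by rewrite andbC ltn_neqAle.
rewrite rowK; set S := (\sum_(_ < _ | _) _).
by apply/rowP => j; rewrite !mxE; ring.
Qed.

Lemma transitions_apply_rows {N n k} (w : 'I_k.+1 -> 'I_N) (Q : 'M[R]_n)
    (h : 'M[R]_(N, n)) :
  transitions w (apply_rows Q h) = apply_rows Q (transitions w h).
Proof.
by apply/row_matrixP => i; rewrite /apply_rows row_mul !rowK !row_mul mulmxBl.
Qed.

Lemma directions_apply_rows {n k} (eps : R) (Q : 'M[R]_n) (D : 'M[R]_(k, n)) :
  orthogonal_map Q ->
  directions eps (apply_rows Q D) = apply_rows Q (directions eps D).
Proof.
move=> hQ; have innerE (u v : 'rV[R]_n) : inner u v = (u *m v^T) 0 0.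
  by rewrite mxE; apply: eq_bigr => j _; rewrite mxE.
apply/row_matrixP => i; rewrite /apply_rows row_mul !rowK row_mul -scalemxAl /norm2.
by rewrite !innerE trmx_mul trmxK mulmxA -(mulmxA _ Q^T) hQ mulmx1.
Qed.

End Losses.

(* Main.v *)
(* Each set of pairs on which the state loss changes is the nonvanishing set of a
   continuous function that is polynomial along every line; on the line from any
   point to a witness it has finitely many zeros, so a single witness already
   makes the set open and dense. The witnesses have equal states at [t], hence
   zero state loss, and are moved apart by the transformation; for transitions,
   one trajectory is zero and the other jumps only at the transition that is
   changed nontrivially. For scalings with [eps > 0], the directions move by
   O(eps) and stay bounded uniformly in [eps], and both losses are polynomials
   in the directions. *)
Require Import Defs.
From HB Require Import structures.
From mathcomp Require Import all_boot all_order all_algebra.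
From mathcomp Require Import all_classical all_reals all_analysis.
From mathcomp Require Import ring lra.
Import Order.TTheory GRing.Theory Num.Theory.
Import numFieldNormedType.Exports.
Local Open Scope classical_set_scope.
Local Open Scope ring_scope.

(** * Exact invariance under offsets, scalings and orthogonal maps *)

Section Invariance.
Context {R : realType}.

Lemma innerE {n} (u v : 'rV[R]_n) : inner u v = (u *m v^T) 0 0.
Proof. by rewrite mxE; apply: eq_bigr => j _; rewrite mxE. Qed.

Lemma inner_ge0 {n} (u : 'rV[R]_n) : 0 <= inner u u.
Proof. by apply: sumr_ge0 => j _; rewrite -expr2 sqr_ge0. Qed.

Lemma inner_eq0 {n} (u : 'rV[R]_n) : (inner u u == 0) = (u == 0).
Proof.
rewrite psumr_eq0; last by move=> j _; rewrite -expr2 sqr_ge0.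
apply/allP/eqP => [u0|-> j _]; last by rewrite mxE mul0r eqxx.
apply/rowP => j; apply/eqP; rewrite mxE.
by have := u0 j (mem_index_enum _); rewrite mulf_eq0 orbb.
Qed.

Lemma norm2_eq0 {n} (u : 'rV[R]_n) : (norm2 u == 0) = (u == 0).
Proof. by rewrite sqrtr_eq0 -inner_eq0 eq_le inner_ge0 andbT. Qed.

Lemma norm2Z {n} (s : R) (u : 'rV[R]_n) :
  0 <= s -> norm2 (s *: u) = s * norm2 u.
Proof.
move=> s0; rewrite /norm2; have -> : inner (s *: u) (s *: u) = s ^+ 2 * inner u u.
  by rewrite !innerE linearZ -scalemxAl -scalemxAr !mxE mulrA expr2.
by rewrite sqrtrM ?sqr_ge0// sqrtr_sqr ger0_norm.
Qed.

Lemma normF_sqr {p q} (A : 'M[R]_(p, q)) :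
  normF A ^+ 2 = \sum_i \sum_j A i j ^+ 2.
Proof.
by rewrite sqr_sqrtr//; do 2 (apply: sumr_ge0 => ? _); exact: sqr_ge0.
Qed.

Lemma state_lossE {N n} (hS hT : 'M[R]_(N, n)) (t : 'I_N) :
  state_loss hS hT t = inner (row t hS - row t hT) (row t hS - row t hT).
Proof. by rewrite /state_loss sqr_sqrtr// inner_ge0. Qed.

Lemma state_loss_eq0 {N n} (hS hT : 'M[R]_(N, n)) (t : 'I_N) :
  (state_loss hS hT t == 0) = (row t hS == row t hT).
Proof. by rewrite state_lossE inner_eq0 subr_eq0. Qed.

Lemma directionsE {n k} (eps : R) (D : 'M[R]_(k, n)) i j :
  directions eps D i j = (norm2 (row i D) + eps)^-1 * D i j.
Proof. by rewrite !mxE. Qed.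

Lemma transitions_add_offset {N n k} (w : 'I_k.+1 -> 'I_N) (c : 'rV[R]_n)
    (h : 'M[R]_(N, n)) :
  transitions w (add_offset c h) = transitions w h.
Proof. by apply/row_matrixP => i; rewrite !rowK opprD addrACA subrr addr0. Qed.

(** Only the positive factor [s i] is cancelled, never the norm, so null rows need no separate
    case. *)
Lemma directions0_scale_rows {n k} (s : 'I_k -> R) (D : 'M[R]_(k, n)) :
  (forall i, 0 < s i) -> directions 0 (scale_rows s D) = directions 0 D.
Proof.
move=> s0; apply/row_matrixP => i; rewrite !rowK !addr0 (norm2Z _ _ (ltW _))//.
by rewrite scalerA invfM mulrAC mulVf ?mul1r// gt_eqF.
Qed.

(** In [d Q^T (d Q^T)^T] the product [Q^T Q] collapses in the middle. Student and teacher Gram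
    matrices are thus fixed separately, which allows two different maps; the direction loss pairs
    the two models and needs a common one. *)
Lemma gram_apply_rows {n k} (Q : 'M[R]_n) (d : 'M[R]_(k, n)) :
  orthogonal_map Q -> gram (apply_rows Q d) = gram d.
Proof.
by move=> hQ; rewrite /gram /apply_rows trmx_mul trmxK mulmxA -(mulmxA d) hQ mulmx1.
Qed.

Lemma dir_loss_apply_rows {n k} (Q : 'M[R]_n) (dS dT : 'M[R]_(k, n)) :
  orthogonal_map Q ->
  dir_loss (apply_rows Q dS) (apply_rows Q dT) = dir_loss dS dT.
Proof.
move=> hQ; congr (_ * _); apply: eq_bigr => i _; congr (_ - _).
by rewrite !innerE !row_mul trmx_mul trmxK mulmxA -(mulmxA (row i dS)) hQ mulmx1.
Qed.

End Invariance.

(** * First-order estimates in [eps] *)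

Section EpsilonClose.
Context {R : realType}.
Implicit Types f g : R -> R.

(** The uniform bounds on [f] and [g] accompany the O(e) estimate so that the relation is stable
    under products, hence under every polynomial expression in the directions. *)
Definition eps_close f g : Prop := exists C : R, forall e, 0 <= e ->
  [/\ `|f e| <= C, `|g e| <= C & `|f e - g e| <= C * e].

Lemma eps_close_cst (c : R) : eps_close (fun=> c) (fun=> c).
Proof. by exists `|c| => e e0; rewrite subrr normr0 mulr_ge0. Qed.

Lemma eps_closeD f g f' g' : eps_close f g -> eps_close f' g' ->
  eps_close (fun e => f e + f' e) (fun e => g e + g' e).
Proof.
move=> [C fg] [C' fg']; exists (C + C') => e e0.
have [f1 g1 fg1] := fg e e0; have [f2 g2 fg2] := fg' e e0.
split.
- by rewrite (le_trans (ler_normD _ _))// lerD.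
- by rewrite (le_trans (ler_normD _ _))// lerD.
- by rewrite opprD addrACA mulrDl (le_trans (ler_normD _ _))// lerD.
Qed.

Lemma eps_closeM f g f' g' : eps_close f g -> eps_close f' g' ->
  eps_close (fun e => f e * f' e) (fun e => g e * g' e).
Proof.
(* One [C * C'] for each term of the splitting [f (f' - g') + (f - g) g'] used below. *)
move=> [C fg] [C' fg']; exists (C * C' + C * C') => e e0.
have [f1 g1 fg1] := fg e e0; have [f2 g2 fg2] := fg' e e0.
have CC'0 : 0 <= C * C'.
  by rewrite mulr_ge0// (le_trans _ f1, le_trans _ f2).
split.
- by rewrite normrM (le_trans (ler_pM _ _ f1 f2))// lerDl.
- by rewrite normrM (le_trans (ler_pM _ _ g1 g2))// lerDl.
- have -> : f e * f' e - g e * g' e = f e * (f' e - g' e) + (f e - g e) * g' e.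
    by ring.
  rewrite (le_trans (ler_normD _ _))// !normrM mulrDl lerD//.
    by rewrite -mulrA ler_pM.
  by rewrite mulrAC ler_pM.
Qed.

Lemma eps_closeB f g f' g' : eps_close f g -> eps_close f' g' ->
  eps_close (fun e => f e - f' e) (fun e => g e - g' e).
Proof.
move=> fg fg'; have := eps_closeD _ _ _ _ fg (eps_closeM _ _ _ _ (eps_close_cst (-1)) fg').
by congr eps_close; apply/funext => e; rewrite mulN1r.
Qed.

Lemma eps_close_sum (I : finType) (F G : I -> R -> R) :
  (forall i, eps_close (F i) (G i)) ->
  eps_close (fun e => \sum_i F i e) (fun e => \sum_i G i e).
Proof.
move=> FG; elim: (index_enum I) => [|i s ih].
  have := eps_close_cst 0.
  by congr eps_close; apply/funext => e; rewrite big_nil.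
have := eps_closeD _ _ _ _ (FG i) ih.
by congr eps_close; apply/funext => e; rewrite big_cons.
Qed.

Lemma eps_close_inner {n} (U U' V V' : R -> 'rV[R]_n) :
  (forall j, eps_close (fun e => U e 0 j) (fun e => U' e 0 j)) ->
  (forall j, eps_close (fun e => V e 0 j) (fun e => V' e 0 j)) ->
  eps_close (fun e => inner (U e) (V e)) (fun e => inner (U' e) (V' e)).
Proof.
by move=> UU' VV'; apply: eps_close_sum => j; exact: eps_closeM.
Qed.

Definition eps_close_mx {p q} (A B : R -> 'M[R]_(p, q)) : Prop :=
  forall i j, eps_close (fun e => A e i j) (fun e => B e i j).

Lemma eps_close_row {p q} (A B : R -> 'M[R]_(p, q)) i : eps_close_mx A B ->
  eps_close_mx (fun e => row i (A e)) (fun e => row i (B e)).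
Proof.
move=> AB i' j; have := AB i j.
by congr eps_close; apply/funext => e; rewrite mxE.
Qed.

(** For a row of norm [a > 0], an entry [x] and a scale [c], the two directions [c x / (c a + e)]
    and [x / (a + e)] differ by [e (c - 1) x / ((c a + e) (a + e))], and the denominators are at
    least [c a] and [a]. *)
Lemma eps_close_directions {n k} (s : 'I_k -> R) (D : 'M[R]_(k, n)) :
  (forall i, 0 < s i) ->
  eps_close_mx (fun e => directions e (scale_rows s D)) (directions^~ D).
Proof.
move=> s0 i j; have := s0 i; set c := s i => c0.
(* A null row gives zero entries for every [e]; it is set apart because the bounds below divide by
   the norm. *)
have [Di0|Di0] := eqVneq (row i D) 0.
  have Dij : D i j = 0 by move/rowP/(_ j): Di0; rewrite !mxE.
  have := eps_close_cst 0.
  by congr eps_close; apply/funext => e; rewrite !mxE Dij !mulr0.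
set a := norm2 (row i D).
have a0 : 0 < a by rewrite lt_neqAle eq_sym norm2_eq0 Di0 sqrtr_ge0.
set x := D i j.
have E e : directions e (scale_rows s D) i j = (c * a + e)^-1 * (c * x).
  by rewrite directionsE rowK (norm2Z _ _ (ltW _))// !mxE.
have ca0 : 0 < c * a by exact: mulr_gt0.
have x0 := normr_ge0 x.
have B1 : 0 <= `|x| / a by rewrite divr_ge0// ltW.
have B2 : 0 <= `|(c - 1) * x| / (c * a * a) by rewrite divr_ge0// ltW// mulr_gt0.
(* The first summand bounds both directions, the second bounds their difference divided by [e]. *)
exists (`|x| / a + `|(c - 1) * x| / (c * a * a)) => e e0.
have ae0 : 0 < a + e by rewrite ltr_wpDr.
have cae0 : 0 < c * a + e by rewrite ltr_wpDr.
rewrite E directionsE -/a -/x; split.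
- apply: ler_wpDr => //; rewrite normrM normfV (gtr0_norm cae0) normrM (gtr0_norm c0).
  rewrite ler_pdivlMr// -mulrA ler_pdivrMl//; nra.
- apply: ler_wpDr => //; rewrite normrM normfV (gtr0_norm ae0).
  rewrite ler_pdivlMr// -mulrA ler_pdivrMl//; nra.
- have -> : (c * a + e)^-1 * (c * x) - (a + e)^-1 * x =
      e * ((c - 1) * x) / ((c * a + e) * (a + e)).
    by field; rewrite !gt_eqF.
  rewrite normrM normfV normrM (ger0_norm e0) (gtr0_norm (mulr_gt0 cae0 ae0)).
  rewrite -mulrA [leRHS]mulrC ler_wpM2l// ler_wpDl// ler_wpM2l// lef_pV2 ?posrE ?mulr_gt0//.
  by apply: ler_pM; rewrite ?lerDl// ltW.
Qed.

Lemma eps_close_dir_loss {n k} (A A' B B' : R -> 'M[R]_(k, n)) :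
  eps_close_mx A A' -> eps_close_mx B B' ->
  eps_close (fun e => dir_loss (A e) (B e)) (fun e => dir_loss (A' e) (B' e)).
Proof.
move=> AA' BB'; apply: (eps_closeM _ _ _ _ (eps_close_cst _)).
apply: eps_close_sum => i; apply: (eps_closeB _ _ _ _ (eps_close_cst _)).
by apply: eps_close_inner; apply: eps_close_row.
Qed.

Lemma eps_close_gram {n k} (A A' : R -> 'M[R]_(k, n)) :
  eps_close_mx A A' ->
  eps_close_mx (fun e => gram (A e)) (fun e => gram (A' e)).
Proof.
move=> AA' i j.
have := eps_close_sum _ _ _ (fun l => eps_closeM _ _ _ _ (AA' i l) (AA' j l)).
by congr eps_close; apply/funext => e; rewrite mxE; apply: eq_bigr => l _; rewrite mxE.
Qed.

Lemma eps_close_geo_loss {n k} (A A' B B' : R -> 'M[R]_(k, n)) :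
  eps_close_mx A A' -> eps_close_mx B B' ->
  eps_close (fun e => geo_loss (A e) (B e)) (fun e => geo_loss (A' e) (B' e)).
Proof.
move=> /eps_close_gram AA' /eps_close_gram BB'.
have H i j := eps_closeB _ _ _ _ (AA' i j) (BB' i j).
have := eps_closeM _ _ _ _ (eps_close_cst (k%:R ^+ 2)^-1)
  (eps_close_sum _ _ _ (fun i => eps_close_sum _ _ _
     (fun j => eps_closeM _ _ _ _ (H i j) (H i j)))).
by congr eps_close; apply/funext => e; rewrite /geo_loss normF_sqr; congr (_ * _);
  apply: eq_bigr => i _; apply: eq_bigr => j _; rewrite !mxE expr2.
Qed.

End EpsilonClose.

(** * Functions polynomial along lines and their nonvanishing sets *)

Section Genericity.
Context {R : realType}.

Section PolynomialFunctions.
Context {V : normedModType R}.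

(** Continuity gives openness of the nonvanishing set and restriction to lines gives its density, so
    one-variable root counting is enough. *)
Definition polyfun (F : V -> R) : Prop :=
  continuous F /\
  forall x y : V, exists p : {poly R}, forall s, F (x + s *: (y - x)) = p.[s].

Lemma polyfun_cst (c : R) : polyfun (fun=> c).
Proof.
split; first by move=> ?; exact: cvg_cst.
by move=> x y; exists c%:P => s; rewrite hornerC.
Qed.

Lemma polyfunD F G : polyfun F -> polyfun G -> polyfun (fun x => F x + G x).
Proof.
move=> [cF pF] [cG pG]; split; first by move=> x; apply: cvgD; [exact: cF|exact: cG].
move=> x y; have [p Fp] := pF x y; have [q Gq] := pG x y.
by exists (p + q) => s; rewrite hornerD Fp Gq.
Qed.

Lemma polyfunM F G : polyfun F -> polyfun G -> polyfun (fun x => F x * G x).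
Proof.
move=> [cF pF] [cG pG]; split; first by move=> x; apply: cvgM; [exact: cF|exact: cG].
move=> x y; have [p Fp] := pF x y; have [q Gq] := pG x y.
by exists (p * q) => s; rewrite hornerM Fp Gq.
Qed.

Lemma polyfunB F G : polyfun F -> polyfun G -> polyfun (fun x => F x - G x).
Proof.
move=> pF pG; have := polyfunD _ _ pF (polyfunM _ _ (polyfun_cst (-1)) pG).
by congr polyfun; apply/funext => x; rewrite mulN1r.
Qed.

Lemma polyfun_sum (I : finType) (P : pred I) (F : I -> V -> R) :
  (forall i, polyfun (F i)) -> polyfun (fun x => \sum_(i | P i) F i x).
Proof.
move=> pF; elim: (index_enum I) => [|i s ih].
  by have := polyfun_cst 0; congr polyfun; apply/funext => x; rewrite big_nil.
case Pi: (P i); last first.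
  by move: ih; congr polyfun; apply/funext => x; rewrite big_cons Pi.
have := polyfunD _ _ (pF i) ih.
by congr polyfun; apply/funext => x; rewrite big_cons Pi.
Qed.

(** A nonzero polynomial has fewer roots than its size, so among [size p] distinct small parameters
    one is not a root. *)
Lemma nonroot_near {U : V -> Prop} (p : {poly R}) (x v : V) :
  nbhs x U -> p != 0 -> exists2 s : R, ~~ root p s & U (x + s *: v).
Proof.
move=> Ux p0.
have : (fun s : R => x + s *: v) @ (0 : R) --> x.
  rewrite -[X in _ --> X]addr0 -(scale0r v).
  by apply: cvgD; [exact: cvg_cst|exact: scalel_continuous].
move=> /(_ U Ux) /nbhs_ballP[e /= e0 eU].
(* Denominators start at 2, so that all parameters lie strictly inside the ball of radius [e]. *)
pose r := [seq e / i.+2%:R | i <- iota 0 (size p)].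
have /allPn[_ /mapP[i _ ->] pi] : ~~ all (root p) r.
  apply/negP => /(max_poly_roots p0); rewrite size_map size_iota ltnn.
  suff -> : uniq r by move=> /(_ isT).
  rewrite map_inj_uniq ?iota_uniq// => i j /(mulfI (lt0r_neq0 e0)) /invr_inj.
  by move=> /eqP; rewrite eqr_nat => /eqP [].
exists (e / i.+2%:R) => //; apply: eU; rewrite /ball/= sub0r normrN.
rewrite gtr0_norm ?divr_gt0// ltr_pdivrMr// ltr_pMr//.
by rewrite ltr1n.
Qed.

Lemma polyfun_neq0_open F : polyfun F -> open [set x | F x != 0].
Proof.
by move=> [cF _]; apply: (@open_comp _ _ F [set y | y != 0]) => [x _|];
  [exact: cF|exact: open_neq].
Qed.

Lemma polyfun_neq0_dense F y : polyfun F -> F y != 0 -> dense [set x | F x != 0].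
Proof.
move=> [_ pF] Fy0 U [x Ux] oU; have [p Fp] := pF x y.
(* At parameter 1 the line reaches the witness [y], where [F] does not vanish. *)
have p0 : p != 0.
  by apply: contraNneq Fy0 => p0; rewrite -(subrKC x y) -(scale1r (y - x)) Fp p0 horner0.
have [s ps Us] := nonroot_near p x (y - x) (open_nbhs_nbhs (conj oU Ux)) p0.
by exists (x + s *: (y - x)); split; rewrite //= Fp.
Qed.

Definition polymx {p q} (F : V -> 'M[R]_(p, q)) : Prop :=
  forall i j, polyfun (fun x => F x i j).

Lemma polymx_cst {p q} (A : 'M[R]_(p, q)) : polymx (fun=> A).
Proof. by move=> i j; exact: polyfun_cst. Qed.

Lemma polymxD {p q} (F G : V -> 'M[R]_(p, q)) :
  polymx F -> polymx G -> polymx (fun x => F x + G x).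
Proof.
move=> pF pG i j; have := polyfunD _ _ (pF i j) (pG i j).
by congr polyfun; apply/funext => x; rewrite mxE.
Qed.

Lemma polymxB {p q} (F G : V -> 'M[R]_(p, q)) :
  polymx F -> polymx G -> polymx (fun x => F x - G x).
Proof.
move=> pF pG i j; have := polyfunB _ _ (pF i j) (pG i j).
by congr polyfun; apply/funext => x; rewrite !mxE.
Qed.

Lemma polymx_sum {p q} (I : finType) (P : pred I) (F : I -> V -> 'M[R]_(p, q)) :
  (forall i, polymx (F i)) -> polymx (fun x => \sum_(i | P i) F i x).
Proof.
move=> pF i j; have := polyfun_sum _ P _ (fun l => pF l i j).
by congr polyfun; apply/funext => x; rewrite summxE.
Qed.

Lemma polymx_mulr {p q r} (F : V -> 'M[R]_(p, q)) (A : 'M[R]_(q, r)) :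
  polymx F -> polymx (fun x => F x *m A).
Proof.
move=> pF i j.
have := polyfun_sum _ xpredT _ (fun l => polyfunM _ _ (pF i l) (polyfun_cst (A l j))).
by congr polyfun; apply/funext => x; rewrite mxE.
Qed.

Lemma polymx_row {p q} (F : V -> 'M[R]_(p, q)) i :
  polymx F -> polymx (fun x => row i (F x)).
Proof.
move=> pF i' j; have := pF i j.
by congr polyfun; apply/funext => x; rewrite mxE.
Qed.

Lemma polymx_rows {p q} (F : 'I_p -> V -> 'rV[R]_q) :
  (forall i, polymx (F i)) -> polymx (fun x => \matrix_(i < p) F i x).
Proof.
move=> pF i j; have := pF i 0 j.
by congr polyfun; apply/funext => x; rewrite mxE.
Qed.

(** Squaring removes the square root of the norm and leaves a sum of squares of entries. *)
Lemma polyfun_state_loss {N n} (F G : V -> 'M[R]_(N, n)) t :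
  polymx F -> polymx G -> polyfun (fun x => state_loss (F x) (G x) t).
Proof.
move=> pF pG; have pd := polymxB _ _ (polymx_row _ t pF) (polymx_row _ t pG).
have := polyfun_sum _ xpredT _ (fun j => polyfunM _ _ (pd 0 j) (pd 0 j)).
by congr polyfun; apply/funext => x; rewrite state_lossE.
Qed.

Lemma polymx_transitions {N n k} (w : 'I_k.+1 -> 'I_N) (F : V -> 'M[R]_(N, n)) :
  polymx F -> polymx (fun x => transitions w (F x)).
Proof.
by move=> pF; apply: polymx_rows => i; apply: polymxB; exact: polymx_row.
Qed.

Lemma polymx_set_transitions {N n k} (w : 'I_k.+1 -> 'I_N)
    (F : V -> 'M[R]_(N, n)) (D : V -> 'M[R]_(k, n)) :
  polymx F -> polymx D -> polymx (fun x => set_transitions w (F x) (D x)).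
Proof.
move=> pF pD; apply: polymx_rows => t; apply: polymxD; first exact: polymx_row.
apply: polymx_sum => i; apply: polymxB; apply: polymx_row => //.
exact: polymx_transitions.
Qed.

End PolynomialFunctions.

Lemma polymx_fst {N n} :
  polymx (fun h : 'M[R]_(N, n) * 'M[R]_(N, n) => h.1).
Proof.
move=> i j; split=> [h|x y].
  by apply: (@continuous_comp _ _ _ fst (fun M : 'M[R]_(N, n) => M i j));
    [exact: cvg_fst|exact: coord_continuous].
exists ((y - x).1 i j *: 'X + (x.1 i j)%:P) => s.
by rewrite !hornerE !mxE addrC mulrC.
Qed.

Lemma polymx_snd {N n} :
  polymx (fun h : 'M[R]_(N, n) * 'M[R]_(N, n) => h.2).
Proof.
move=> i j; split=> [h|x y].
  by apply: (@continuous_comp _ _ _ snd (fun M : 'M[R]_(N, n) => M i j));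
    [exact: cvg_snd|exact: coord_continuous].
exists ((y - x).2 i j *: 'X + (x.2 i j)%:P) => s.
by rewrite !hornerE !mxE addrC mulrC.
Qed.

(** The change of the loss is a [polyfun]. At [h0] the original loss is zero and the transformed one
    is not, so [h0] is the required witness. *)
Lemma generic_state_loss {N n}
    (F G : 'M[R]_(N, n) * 'M[R]_(N, n) -> 'M[R]_(N, n)) t h0 :
  polymx F -> polymx G ->
  row t h0.1 = row t h0.2 -> row t (F h0) <> row t (G h0) ->
  generic [set h | state_loss (F h) (G h) t <> state_loss h.1 h.2 t].
Proof.
move=> pF pG h0E FG; pose H h := state_loss (F h) (G h) t - state_loss h.1 h.2 t.
have pH : polyfun H.
  by apply: polyfunB; apply: polyfun_state_loss => //;
    [exact: polymx_fst|exact: polymx_snd].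
have -> : [set h | state_loss (F h) (G h) t <> state_loss h.1 h.2 t] =
    [set h | H h != 0].
  by apply/seteqP; split=> h /=; rewrite subr_eq0 => /eqP.
split; first exact: polyfun_neq0_open.
apply: (polyfun_neq0_dense _ h0) => //.
rewrite /H (_ : state_loss h0.1 _ _ = 0) ?subr0 ?state_loss_eq0; first exact/eqP.
by apply/eqP; rewrite state_loss_eq0 h0E.
Qed.

(** Supplies the vector from which witnesses are built; some unit vector already separates the
    matrices. *)
Lemma mulmx_row_neq {p q} (A B : 'M[R]_(p, q)) :
  A <> B -> exists u : 'rV[R]_p, u *m A <> u *m B.
Proof.
move=> AB; apply: contrapT => /forallNP uAB; apply: AB.
by apply/row_matrixP => i; rewrite !rowE; exact: contrapT (uAB _).
Qed.

(** A common form for scalings (scalar matrices) and orthogonal maps (a constant family), so that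
    one genericity argument covers both. *)
Definition mul_rows {n k} (A : 'I_k -> 'M[R]_n) (D : 'M[R]_(k, n)) : 'M[R]_(k, n) :=
  \matrix_(i < k) (row i D *m A i).

Lemma scale_rowsE {n k} (s : 'I_k -> R) :
  @scale_rows R n k s = mul_rows (fun i => (s i)%:M).
Proof. by apply/funext => D; apply/row_matrixP => i; rewrite !rowK mul_mx_scalar. Qed.

Lemma apply_rowsE {n k} (Q : 'M[R]_n) :
  apply_rows Q = @mul_rows n k (fun=> Q^T).
Proof. by apply/funext => D; apply/row_matrixP => i; rewrite rowK row_mul. Qed.

(** * Witnesses with a single nonzero transition *)

Section Transitions.
Context {N n k : nat} (w : 'I_k.+1 -> 'I_N).
Context (hw : forall i j : 'I_k.+1, (i < j)%N -> (w i < w j)%N).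

Lemma leq_positions i j : (w i <= w j)%N = (i <= j)%N.
Proof.
case: (ltnP j i) => [/hw|]; first by rewrite ltnNge => /negbTE.
by rewrite leq_eqVlt => /orP[/eqP/val_inj ->|/hw /ltnW ->]; rewrite ?leqnn.
Qed.

(** Falling to 0, rather than rising from it, makes this trajectory agree with the zero one after
    the jump, while its initial state, which [set_transitions] keeps, is [u]. *)
Definition jump (i : 'I_k) (u : 'rV[R]_n) : 'M[R]_(N, n) :=
  \matrix_(t < N) (if (t <= w (from_pos i))%N then u else 0).

Lemma row_transitions_jump i u j :
  row j (transitions w (jump i u)) = if j == i then - u else 0.
Proof.
rewrite !rowK !leq_positions /= /bump leq0n add1n -val_eqE/=.
(* Both endpoints carry [u] when [j < i] and 0 when [j > i]; only [j = i] passes from [u] to 0. *)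
by case: ltngtP; rewrite ?subrr ?sub0r.
Qed.

Lemma row_jump i u (t : 'I_N) : (w (to_pos i) <= t)%N -> row t (jump i u) = 0.
Proof.
move=> it; rewrite rowK ifF//; apply/negbTE; rewrite -ltnNge.
by apply: leq_trans it; apply: hw; rewrite /= /bump leq0n.
Qed.

(** The state at [t] was 0 and receives the change of transition [i], from [- u] to [- u A_i]; the
    other transitions are null and stay so. *)
Lemma row_set_transitions_jump A i u (t : 'I_N) : (w (to_pos i) <= t)%N ->
  row t (set_transitions w (jump i u) (mul_rows A (transitions w (jump i u)))) =
  u - u *m A i.
Proof.
move=> it; rewrite rowK row_jump// add0r (bigD1 i)//= big1 ?addr0.
  by rewrite rowK row_transitions_jump eqxx mulNmx opprK addrC.
move=> j /andP[_ /negbTE ji].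
by rewrite rowK row_transitions_jump ji mul0mx subrr.
Qed.

Lemma row_set_transitions0 A (t : 'I_N) :
  row t (set_transitions w 0 (mul_rows A (transitions w (0 : 'M[R]_(N, n))))) = 0.
Proof.
rewrite rowK row0 add0r big1// => i _.
by rewrite rowK (_ : row i _ = 0) ?mul0mx ?subrr// rowK !row0 subrr.
Qed.

Lemma generic_set_transitions (AS AT : 'I_k -> 'M[R]_n) (t : 'I_N) i :
  (w (to_pos i) <= t)%N -> AS i <> 1%:M \/ AT i <> 1%:M ->
  generic [set h : 'M[R]_(N, n) * 'M[R]_(N, n) |
    state_loss (set_transitions w h.1 (mul_rows AS (transitions w h.1)))
               (set_transitions w h.2 (mul_rows AT (transitions w h.2))) t
    <> state_loss h.1 h.2 t].
Proof.
move=> it A1.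
(* The jump is given to a model whose matrix at [i] is not the identity, with [u] moved by that
   matrix; the other trajectory is zero. *)
have [h0 h0E h0N] : exists2 h0 : 'M[R]_(N, n) * 'M[R]_(N, n),
    row t h0.1 = row t h0.2 &
    row t (set_transitions w h0.1 (mul_rows AS (transitions w h0.1))) <>
    row t (set_transitions w h0.2 (mul_rows AT (transitions w h0.2))).
  case: A1 => /mulmx_row_neq[u]; rewrite mulmx1 => uA.
    exists (jump i u, 0); rewrite /= ?row_jump ?row0//.
    rewrite row_set_transitions_jump// row_set_transitions0.
    by move=> /subr0_eq/esym.
  exists (0, jump i u); rewrite /= ?row_jump ?row0//.
  rewrite row_set_transitions_jump// row_set_transitions0.
  by move=> /esym/subr0_eq/esym.
apply: (generic_state_loss _ _ _ h0) => //; apply: polymx_set_transitions.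
- exact: polymx_fst.
- by apply: polymx_rows => j; apply/polymx_mulr/polymx_row/polymx_transitions/polymx_fst.
- exact: polymx_snd.
- by apply: polymx_rows => j; apply/polymx_mulr/polymx_row/polymx_transitions/polymx_snd.
Qed.

End Transitions.

End Genericity.

(** * Invariance of the two losses and generic change of the state loss *)

Theorem proposition1 (R : realType) (N n k : nat) (w : 'I_k.+1 -> 'I_N)
  (hk : (0 < k)%N)
  (hw : forall i j : 'I_k.+1, (i < j)%N -> (w i < w j)%N) :
  (* offsets *)
  (forall (eps : R) (hS hT : 'M[R]_(N, n)) (cS cT : 'rV[R]_n), 0 <= eps ->
     dir_loss (directions eps (transitions w (add_offset cS hS)))
              (directions eps (transitions w (add_offset cT hT)))
     = dir_loss (directions eps (transitions w hS))
                (directions eps (transitions w hT))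
     /\
     geo_loss (directions eps (transitions w (add_offset cS hS)))
              (directions eps (transitions w (add_offset cT hT)))
     = geo_loss (directions eps (transitions w hS))
                (directions eps (transitions w hT)))
  /\
  (* positive scalings of the transitions: exact for eps = 0 *)
  (forall (hS hT : 'M[R]_(N, n)) (sS sT : 'I_k -> R),
     (forall i, 0 < sS i) -> (forall i, 0 < sT i) ->
     dir_loss (directions 0 (scale_rows sS (transitions w hS)))
              (directions 0 (scale_rows sT (transitions w hT)))
     = dir_loss (directions 0 (transitions w hS))
                (directions 0 (transitions w hT))
     /\
     geo_loss (directions 0 (scale_rows sS (transitions w hS)))
              (directions 0 (scale_rows sT (transitions w hT)))
     = geo_loss (directions 0 (transitions w hS))
                (directions 0 (transitions w hT)))
  /\
  (* positive scalings of the transitions: up to O(eps) in general *)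
  (forall (hS hT : 'M[R]_(N, n)) (sS sT : 'I_k -> R),
     (forall i, 0 < sS i) -> (forall i, 0 < sT i) ->
     exists C : R, forall eps : R, 0 <= eps ->
     `| dir_loss (directions eps (scale_rows sS (transitions w hS)))
                 (directions eps (scale_rows sT (transitions w hT)))
        - dir_loss (directions eps (transitions w hS))
                   (directions eps (transitions w hT)) | <= C * eps
     /\
     `| geo_loss (directions eps (scale_rows sS (transitions w hS)))
                 (directions eps (scale_rows sT (transitions w hT)))
        - geo_loss (directions eps (transitions w hS))
                   (directions eps (transitions w hT)) | <= C * eps)
  /\
  (* orthogonal maps acting on the directions *)
  (forall (eps : R) (hS hT : 'M[R]_(N, n)), 0 <= eps ->
     (forall QS QT : 'M[R]_n, orthogonal_map QS -> orthogonal_map QT ->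
        geo_loss (apply_rows QS (directions eps (transitions w hS)))
                 (apply_rows QT (directions eps (transitions w hT)))
        = geo_loss (directions eps (transitions w hS))
                   (directions eps (transitions w hT)))
     /\
     (forall Q : 'M[R]_n, orthogonal_map Q ->
        dir_loss (apply_rows Q (directions eps (transitions w hS)))
                 (apply_rows Q (directions eps (transitions w hT)))
        = dir_loss (directions eps (transitions w hS))
                   (directions eps (transitions w hT))))
  /\
  (* the state loss changes for generic trajectories: under offsets, *)
  (forall (cS cT : 'rV[R]_n) (t : 'I_N), cS <> cT ->
     generic [set h : 'M[R]_(N, n) * 'M[R]_(N, n) |
       state_loss (add_offset cS h.1) (add_offset cT h.2) t
       <> state_loss h.1 h.2 t])
  /\
  (* under positive scalings of the transitions, *)
  (forall (sS sT : 'I_k -> R) (t : 'I_N), (0 < n)%N ->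
     (forall i, 0 < sS i) -> (forall i, 0 < sT i) ->
     (exists i : 'I_k, (w (to_pos i) <= t)%N /\ (sS i <> 1 \/ sT i <> 1)) ->
     generic [set h : 'M[R]_(N, n) * 'M[R]_(N, n) |
       state_loss (set_transitions w h.1 (scale_rows sS (transitions w h.1)))
                  (set_transitions w h.2 (scale_rows sT (transitions w h.2))) t
       <> state_loss h.1 h.2 t])
  /\
  (* under orthogonal maps of the transitions (initial states kept), *)
  (forall (QS QT : 'M[R]_n) (t : 'I_N), orthogonal_map QS -> orthogonal_map QT ->
     (exists i : 'I_k, (w (to_pos i) <= t)%N) -> (QS <> 1%:M \/ QT <> 1%:M) ->
     generic [set h : 'M[R]_(N, n) * 'M[R]_(N, n) |
       state_loss (set_transitions w h.1 (apply_rows QS (transitions w h.1)))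
                  (set_transitions w h.2 (apply_rows QT (transitions w h.2))) t
       <> state_loss h.1 h.2 t])
  /\
  (* and under distinct orthogonal maps of the states themselves *)
  (forall (QS QT : 'M[R]_n) (t : 'I_N), orthogonal_map QS -> orthogonal_map QT ->
     QS <> QT ->
     generic [set h : 'M[R]_(N, n) * 'M[R]_(N, n) |
       state_loss (apply_rows QS h.1) (apply_rows QT h.2) t <> state_loss h.1 h.2 t]).
Proof.
split=> [eps hS hT cS cT _|]; first by rewrite !transitions_add_offset.
split=> [hS hT sS sT sS0 sT0|]; first by rewrite !directions0_scale_rows.
split=> [hS hT sS sT sS0 sT0|].
  have cS := eps_close_directions sS (transitions w hS) sS0.
  have cT := eps_close_directions sT (transitions w hT) sT0.
  have [C dirC] := eps_close_dir_loss _ _ _ _ cS cT.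
  have [C' geoC] := eps_close_geo_loss _ _ _ _ cS cT.
  exists (Num.max C C') => eps eps0.
  have [_ _ dirE] := dirC eps eps0; have [_ _ geoE] := geoC eps eps0.
  split; [apply: le_trans dirE _|apply: le_trans geoE _];
    by rewrite ler_wpM2r// le_max lexx ?orbT.
split=> [eps hS hT _|].
  split=> [QS QT oS oT|Q oQ]; last exact: dir_loss_apply_rows.
  by rewrite /geo_loss !gram_apply_rows.
split=> [cS cT t cST|].
  (* From two zero trajectories the offsets produce the distinct states [cS] and [cT]. *)
  apply: (generic_state_loss _ _ _ (0, 0)) => //=.
  - by apply: polymx_rows => i; apply: polymxD;
      [exact/polymx_row/polymx_fst|exact: polymx_cst].
  - by apply: polymx_rows => i; apply: polymxD;
      [exact/polymx_row/polymx_snd|exact: polymx_cst].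
  - by rewrite !rowK row0 !add0r.
split=> [sS sT t n0 _ _ [i [it s1]]|].
  rewrite !scale_rowsE; apply: (generic_set_transitions _ hw _ _ _ i it).
  (* Positive dimension provides a diagonal entry; in dimension 0 all scalar matrices coincide. *)
  have scalar1 (c : R) : c <> 1 -> c%:M <> 1%:M :> 'M[R]_n.
    by move=> c1 /matrixP/(_ (Ordinal n0) (Ordinal n0)); rewrite !mxE eqxx.
  by case: s1 => /scalar1; [left|right].
split=> [QS QT t _ _ [i it] Q1|QS QT t _ _ QST].
  rewrite !apply_rowsE; apply: (generic_set_transitions _ hw _ _ _ i it).
  by case: Q1 => Q1; [left|right] => /(congr1 trmx); rewrite trmxK trmx1.
(* Both trajectories are constantly [u], a vector on which the two maps disagree. *)
have /mulmx_row_neq[u uQ] : QS^T <> QT^T by move=> /trmx_inj.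
apply: (generic_state_loss _ _ _ (\matrix_t u, \matrix_t u)) => //=.
- exact/polymx_mulr/polymx_fst.
- exact/polymx_mulr/polymx_snd.
- by rewrite !row_mul !rowK.
Qed.
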